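(* Let $\mathbb{P}$ be a translation-invariant Borel probability measure on $\Omega=[0,\infty)^{\mathbb{Z}^2}$. Let $a\in\mathbb{Z}_+^2$ and let $A\subset\mathbb{T}$ be a subset satisfying the growth property (such that the events $\{\mathcal{T}_{a+(1,1)}\in A\}$ and $\{\mathcal{T}_{(1,1)}\in A\}$ are measurable). Set $$\Omega^{a}=\left\{\omega\in\Omega : a \text{ belongs to } \gamma_{a+(1,0)}^\omega \text{ and } \gamma_{a+(0,1)}^\omega\right\}.$$ Then $$\mathbb{P}\left(\{\mathcal{T}_{a+(1,1)}\in A\}\cap\Omega^{a}\right)\le \mathbb{P}\left(\{\mathcal{T}_{(1,1)}\in A\}\cap\tau_a(\Omega^{a})\right),$$ where $\tau_a(\Omega^a)$ is the image of $\Omega^a$ under $\tau_a$. In particular, if $\mathbb{P}$ is in addition a product measure (and $\mathbb{P}(\Omega^a)>0$), then $$\mathbb{P}\left(\mathcal{T}_{a+(1,1)}\in A\,\mid\,\Omega^{a}\right)\le \mathbb{P}\left(\mathcal{T}_{(1,1)}\in A\right).$$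
   Context: $\mathbb{Z}_+=\{0,1,2,\ldots\}$. $\Omega=[0,\infty)^{\mathbb{Z}^2}$ is the configuration space, with its Borel $\sigma$-algebra for the product topology. For $a\in\mathbb{Z}^2$, the translation $\tau_a:\Omega\to\Omega$ is $\tau_a(\omega)=\omega(a+\cdot)$. $\mathbb{P}$ is translation-invariant if $\mathbb{P}=\mathbb{P}\circ\tau_a^{-1}$ for all $a\in\mathbb{Z}^2$. Paths: a path is a (finite or infinite) sequence $\gamma=(z_0,z_1,\ldots)$ of sites of $\mathbb{Z}^2$ with $z_{i+1}-z_i\in\{(1,0),(0,1)\}$. Its length for $\omega\in\Omega$ is $\omega(\gamma)=\sum_{z\in\gamma}\omega(z)$. For $z\in\mathbb{Z}_+^2$, $\Gamma_z$ is the finite set of paths from $(0,0)$ to $z$; $\gamma\in\Gamma_z$ is $\omega$-optimal if $\omega(\gamma)$ is maximal over $\Gamma_z$. For two paths in $\Gamma_z$, $\gamma$ is below $\gamma'$ if at each step the second coordinate of the site of $\gamma$ is at most that of the corresponding site of $\gamma'$. The low-optimal path $\gamma_z^\omega$ is the unique $\omega$-optimal path of $\Gamma_z$ lying below all other $\omega$-optimal paths of $\Gamma_z$ (it always exists). Trees: the last passage percolation tree $\mathcal{T}^\omega$ is the collection of all low-optimal paths $\gamma_z^\omega$, $z\in\mathbb{Z}_+^2$, viewed as a tree rooted at $(0,0)$ with vertex set $\mathbb{Z}_+^2$ (each $u\neq(0,0)$ is joined to the site preceding it on $\gamma_u^\omega$). For $z\in\mathbb{Z}_+^2$, $\mathcal{T}_z^\omega$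 is the subtree of $\mathcal{T}^\omega$ rooted at $z$; its vertex set is $\{u\in\mathbb{Z}_+^2 : z\in\gamma_u^\omega\}$. $\mathcal{T}_z$ denotes the random tree $\omega\mapsto\mathcal{T}_z^\omega$. Set $\mathbb{T}=\{\mathcal{T}_z^\omega : z\in\mathbb{Z}_+^2,\ \omega\in\Omega\}$. For $T\in\mathbb{T}$, $r(T)$ is its root, $V(T)$ its vertex set, and $V(T)-r(T)=\{v-r(T): v\in V(T)\}$ is the vertex set translated so that the root is at the origin. Growth property: a subset $A\subset\mathbb{T}$ satisfies the growth property if, whenever $T\in A$, $T'\in\mathbb{T}$ and $V(T)-r(T)\subset V(T')-r(T')$, one has $T'\in A$. *)

(* Defs.v *)
From HB Require Import structures.
From mathcomp Require Import all_boot all_order all_algebra finmap.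
From mathcomp Require Import all_classical all_reals all_analysis.
Set Implicit Arguments.
Unset Strict Implicit.
Unset Printing Implicit Defensive.
Import Order.TTheory GRing.Theory Num.Theory.
Import numFieldNormedType.Exports.
Local Open Scope classical_set_scope.
Local Open Scope ring_scope.

Definition site : Type := (int * int)%type.
HB.instance Definition _ := GRing.Zmodule.on site.

Definition site10 : site := (1, 0).
Definition site01 : site := (0, 1).

Definition quadrant : set site := [set z | 0 <= z.1 /\ 0 <= z.2].

(* The half-line [0, +oo[ with the topology induced by that of R. *)
Definition half_line (R : realType) : Type := set_type [set x : R | 0 <= x].

Section half_line_instances.
Variable R : realType.

HB.instance Definition _ := Topological.copy (half_line R)
  (set_type [set x : R | 0 <= x]).

Let half_line0 : half_line R := exist _ 0 (mem_set (lexx (0 : R))).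
HB.instance Definition _ := isPointed.Build (half_line R) half_line0.
End half_line_instances.

(* The type former ptws carries the product topology. *)
Definition config (R : realType) : Type := {ptws site -> half_line R}.

HB.instance Definition _ (R : realType) := Topological.copy (config R)
  {ptws site -> half_line R}.
HB.instance Definition _ (R : realType) :=
  Pointed.copy (config R) (site -> half_line R).

Notation borel T := (g_sigma_algebraType (@open T)).

Section last_passage.
Variable R : realType.
Implicit Types (w : config R) (a z u v : site) (g : seq site).

Definition translate a w : config R := fun z => w (a + z).

Definition upright_step : rel site :=
  [rel z z' | (z' - z == site10) || (z' - z == site01)].

(* A finite path is represented by the sequence of all its sites, including
   its starting point. *)
Definition paths_to z : set (seq site) :=
  [set g | exists s, [/\ g = 0 :: s, path upright_step 0 s & last 0 s = z]].

Definition path_length w g : R := \sum_(z <- g) set_val (w z).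

Definition optimal w z g : Prop :=
  paths_to z g /\
  forall g', paths_to z g' -> path_length w g' <= path_length w g.

Definition below g g' : Prop :=
  forall i, (i < size g)%N -> (nth 0 g i).2 <= (nth 0 g' i).2.

Definition low_optimal w z g : Prop :=
  optimal w z g /\ forall g', optimal w z g' -> below g g'.

(* The low-optimal path to z; for z in the quadrant it exists and is unique,
   and the default value [::] plays no role. *)
Definition low_path w z : seq site := xget [::] (low_optimal w z).

Record rooted_tree := RootedTree {
  tree_root : site ;
  tree_vertices : set site ;
  tree_edges : set (site * site) (* pairs (parent, child) *)
}.

Definition lpp_tree w : rooted_tree := RootedTree 0 quadrant
  [set vu | quadrant vu.2 /\
    exists s, low_path w vu.2 = s ++ [:: vu.1; vu.2]].

Definition lpp_subtree w z : rooted_tree :=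
  let V := [set u | quadrant u /\ z \in low_path w u] in
  RootedTree z V (tree_edges (lpp_tree w) `&` (V `*` V)).

Definition all_trees : set rooted_tree :=
  [set T | exists w z, quadrant z /\ T = lpp_subtree w z].

Definition rooted_vertices (T : rooted_tree) : set site :=
  [set v - tree_root T | v in tree_vertices T].

Definition growth_property (A : set rooted_tree) : Prop :=
  A `<=` all_trees /\
  forall T T', A T -> all_trees T' ->
    rooted_vertices T `<=` rooted_vertices T' -> A T'.

Definition subtree_in z (A : set rooted_tree) : set (borel (config R)) :=
  [set w | A (lpp_subtree w z)].

Definition Omega_at a : set (borel (config R)) :=
  [set w | a \in low_path w (a + site10) /\ a \in low_path w (a + site01)].

Definition translation_invariant (P : probability (borel (config R)) R) :=
  forall a (B : set (borel (config R))), measurable B ->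
    P (translate a @^-1` B) = P B.

(* P is the product of its one-site marginals mu_z, characterised on finite
   dimensional cylinders. *)
Definition product_measure (P : probability (borel (config R)) R) : Prop :=
  exists mu : site -> probability (borel (half_line R)) R,
    forall (F : {fset site}) (B : site -> set (borel (half_line R))),
      (forall z, measurable (B z)) ->
      P [set w | forall z, z \in F -> B z (w z)] =
        (\prod_(z <- F) mu z (B z))%E.

End last_passage.
Arguments all_trees R : clear implicits.
Arguments growth_property R A : clear implicits.
Arguments subtree_in R z%_R A : clear implicits.
Arguments Omega_at R a%_R : clear implicits.

Definition cond_prob d (T : measurableType d) (R : realType)
  (P : probability T R) (E F : set T) : \bar R := (P (E `&` F) / P F)%E.

(* Main.v *)
(* On Omega^a the low-optimal path to any site of T_{a+(1,1)} enters a+(1,1)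
   through a+(1,0) or a+(0,1), and its initial segment up to there is itself
   low-optimal, so it passes through a. The part of the path after a is then
   low-optimal for the translated weights, so T_{a+(1,1)}, translated by -a, is
   contained in the tree T_{(1,1)} of the translated configuration. The growth
   property and translation invariance give the first inequality.
   For a product measure, T_{(1,1)} only depends on the weights of the nonzero
   sites of the quadrant, since all paths start at 0; while tau_a(Omega^a) only
   depends on the weights of the sites of level (sum of coordinates) at most 0,
   since all paths to a+(1,0), resp. a+(0,1), end with the same site. These sets
   of sites are disjoint, whence independence. *)
Require Import Defs.
From mathcomp Require Import all_boot all_order all_algebra finmap.
From mathcomp Require Import all_classical all_reals all_analysis.
From mathcomp Require Import zify.
Set Implicit Arguments.
Unset Strict Implicit.
Unset Printing Implicit Defensive.
Import Order.TTheory GRing.Theory Num.Theory.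
Import numFieldNormedType.Exports.
Local Open Scope classical_set_scope.
Local Open Scope ring_scope.

(** * Up-right paths: levels, concatenation and translation *)

Definition path_from (x z : site) : set (seq site) :=
  [set g | exists s, [/\ g = x :: s, path upright_step x s & last x s = z]].

(** Every up-right step raises it by one, so the level of a site determines its position on a
    path. *)
Definition level (z : site) : int := z.1 + z.2.

Lemma site_addE (x y : site) : x + y = (x.1 + y.1, x.2 + y.2).
Proof. by []. Qed.

Lemma site_subE (x y : site) : x - y = (x.1 - y.1, x.2 - y.2).
Proof. by []. Qed.

Lemma quadrant_ge0 (z : site) :
  quadrant z <-> (0 : int) <= z.1 /\ (0 : int) <= z.2.
Proof. by []. Qed.

Lemma upright_stepP (x y : site) :
  reflect (y = x + site10 \/ y = x + site01) (upright_step x y).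
Proof.
rewrite /upright_step /= !subr_eq ![_ + x]addrC.
by apply: (iffP orP) => -[/eqP|/eqP]; auto.
Qed.

Lemma upright_step_shift (a x y : site) :
  upright_step (a + x) (a + y) = upright_step x y.
Proof. by rewrite /upright_step /= [a + y]addrC addrKA [y - _]addrC addrC. Qed.

Lemma path_from_level (x z : site) g i : path_from x z g -> (i < size g)%N ->
  level (nth 0 g i) = level x + i%:Z.
Proof.
case=> s [-> + _]; elim: s x i => [|y s IH] x [|i] //=; rewrite ?addr0 //.
move=> /andP[/upright_stepP xy pth] lti; rewrite IH // /level.
by case: xy => ->; rewrite site_addE /=; lia.
Qed.

Lemma path_from_size (x z : site) g :
  path_from x z g -> level z = level x + (size g).-1%:Z.
Proof.
move=> pg; have := pg => -[s [gE _ <-]].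
have := @path_from_level x z g (size s) pg.
by rewrite gE /= -last_nth => ->.
Qed.

Lemma path_from_eq_size (x z : site) g g' :
  path_from x z g -> path_from x z g' -> size g = size g'.
Proof.
move=> pg pg'; have := path_from_size pg; rewrite (path_from_size pg').
by case: pg => s [-> _ _]; case: pg' => s' [-> _ _] /=; lia.
Qed.

Lemma path_from_ge (x z u : site) g : path_from x z g -> u \in g ->
  x.1 <= u.1 /\ x.2 <= u.2.
Proof.
case=> s [-> + _]; elim: s x => [|y s IH] x /=.
  by rewrite inE => _ /eqP ->.
move=> /andP[/upright_stepP xy pth]; rewrite inE => /orP[/eqP -> //|uys].
have := IH _ pth uys.
by case: xy => ->; rewrite site_addE /=; lia.
Qed.

Lemma path_from_end (x z : site) g : path_from x z g ->
  exists p, g = rcons p z.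
Proof. by case=> s [-> _ <-]; exists (belast x s); rewrite -lastI. Qed.

Lemma path_from_cat (x y z : site) p q : path_from x z (p ++ y :: q) <->
  path_from x y (rcons p y) /\ path_from y z (y :: q).
Proof.
split.
  case: p => [|x' p] [s [/= [<- <-]]].
    by move=> ps <-; split; [exists [::] | exists q].
  rewrite cat_path last_cat /= => /and3P[p1 p2 p3] ls; split.
    by exists (rcons p y); rewrite rcons_path last_rcons p1.
  by exists q.
case=> -[s [ps pths ls]] [s' [/= [<-] pths' ls']].
case: p ps => [|x' p] /= [xE sE]; rewrite -xE in pths *; first by exists q.
exists (p ++ y :: q); split => //; last by rewrite last_cat.
by move: pths; rewrite -sE rcons_path cat_path /= pths' andbT.
Qed.

Lemma path_from_shift (a x z : site) g : path_from x z g ->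
  path_from (a + x) (a + z) [seq a + u | u <- g].
Proof.
case=> s [-> pths ls]; exists [seq a + u | u <- s]; split => //.
  rewrite path_map; apply: sub_path pths => u v /=.
  by rewrite -!/(upright_step _ _) upright_step_shift.
by rewrite last_map ls.
Qed.

(** * Low-optimal paths under cutting and translation *)

Section low_optimal_paths.
Variable R : realType.
Implicit Types (w : config R) (a z u v y : site) (g p q : seq site).

Lemma path_length_cat w p q :
  path_length w (p ++ q) = path_length w p + path_length w q.
Proof. exact: big_cat. Qed.

Lemma path_length_shift w a g :
  path_length (translate a w) g = path_length w [seq a + u | u <- g].
Proof. by rewrite /path_length big_map. Qed.

(* Uniqueness of low-optimal paths is all that is needed: when there is none,
   [low_path w z] is empty, so every membership [u \in low_path w z] yields a
   genuine low-optimal path. *)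
Lemma low_optimal_uniq w z g g' :
  low_optimal w z g -> low_optimal w z g' -> g = g'.
Proof.
move=> [og lg] [og' lg'].
have pg : path_from 0 z g by case: og.
have pg' : path_from 0 z g' by case: og'.
have sgg' := path_from_eq_size pg pg'.
apply: (@eq_from_nth _ 0) => // i ig.
have ig' : (i < size g')%N by rewrite -sgg'.
have := path_from_level pg ig; rewrite -(path_from_level pg' ig').
have := lg _ og' _ ig; have := lg' _ og _ ig'; rewrite /level.
case: (nth _ g i) (nth _ g' i) => [x1 x2] [y1 y2] /= *.
by congr pair; lia.
Qed.

Lemma low_path_eq w z g : low_optimal w z g -> low_path w z = g.
Proof.
by move=> lg; apply: xget_unique => // g' /low_optimal_uniq; apply.
Qed.

Lemma mem_low_path w z u :
  u \in low_path w z <-> exists g, low_optimal w z g /\ u \in g.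
Proof.
split; last by move=> [g [/low_path_eq ->]].
rewrite /low_path; case: xgetP => [g _ lg ug|_]; last by rewrite in_nil.
by exists g.
Qed.

(** A competitor to [y] prolonged by [q] is a competitor to [z]; the weight of [q] cancels, and
    [below] for the prolonged paths restricts to the initial segments, which have equal size. *)
Lemma low_optimal_prefix w z y p q :
  low_optimal w z (p ++ y :: q) -> low_optimal w y (rcons p y).
Proof.
case=> -[pg og] lg; have [py pq] := (path_from_cat 0 y z p q).1 pg.
have ext g' : path_from 0 y g' ->
    exists p', g' = rcons p' y /\ paths_to z (p' ++ y :: q).
  move=> pg'; have [p' g'E] := path_from_end pg'.
  by exists p'; split=> //; apply/path_from_cat; rewrite -g'E.
split.
  split=> // g' /ext[p' [-> /og]].
  by rewrite -2!cat_rcons 2!path_length_cat lerD2r.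
move=> g' [pg' og'] i ilt; have sg' := path_from_eq_size py pg'.
have [p' [g'E pg'q]] := ext _ pg'.
have /lg/(_ i) : optimal w z (p' ++ y :: q).
  split=> // g'' /og /le_trans; apply; move: (og' _ py).
  by rewrite g'E -2!cat_rcons 2!path_length_cat lerD2r.
by rewrite -2!cat_rcons !nth_cat -g'E -sg' ilt size_cat; apply; lia.
Qed.

(** The mirrored exchange: a competitor for the translated weights is moved back by [a] and glued
    after [p], whose weight cancels. *)
Lemma low_optimal_suffix w z a p q : low_optimal w z (p ++ a :: q) ->
  low_optimal (translate a w) (z - a) [seq - a + u | u <- a :: q].
Proof.
case=> -[pg og] lg; have [py pq] := (path_from_cat 0 a z p q).1 pg.
have pqa : paths_to (z - a) [seq - a + u | u <- a :: q].
  by have := path_from_shift (- a) pq; rewrite addNr addrC.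
have ext g' : paths_to (z - a) g' ->
    exists q', [seq a + u | u <- g'] = a :: q' /\ paths_to z (p ++ a :: q').
  move=> /(path_from_shift a); rewrite addr0 [a + _]addrC subrK => pg'.
  have [q' [q'E _ _]] := pg'.
  by exists q'; split=> //; apply/path_from_cat; rewrite -q'E.
have shiftK : [seq a + u | u <- [seq - a + u | u <- a :: q]] = a :: q.
  by rewrite -map_comp -[RHS]map_id; apply: eq_map => u /=; rewrite addNKr.
split.
  split=> // g' /ext[q' [q'E /og]].
  by rewrite !path_length_shift shiftK q'E !path_length_cat lerD2l.
move=> g' [pg' og'] i ilt.
have sg' := path_from_eq_size pqa pg'.
have [q' [q'E pg'q]] := ext _ pg'.
have /lg/(_ (size p + i)%N) : optimal w z (p ++ a :: q').
  split=> // g'' /og /le_trans; apply; move: (og' _ pqa).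
  by rewrite !path_length_shift shiftK q'E !path_length_cat lerD2l.
(* With the translated suffix named [r], [a :: q] becomes its shift by [a], and both compared sites
   are shifts. *)
move: [seq - a + u | u <- a :: q] shiftK ilt sg' {pqa} => r <- ilt sg'.
rewrite -q'E !nth_cat [(_ < size p)%N]ltnNge leq_addr /= addKn.
rewrite size_cat size_map ltn_add2l.
by move=> /(_ ilt); rewrite !(nth_map 0) -?sg' // lerD2l.
Qed.

Lemma low_path_prefix w z p y q :
  low_optimal w z (p ++ y :: q) -> low_path w y = rcons p y.
Proof. by move=> /low_optimal_prefix/low_path_eq. Qed.

(** Once both roots are moved to the origin, this is the inclusion of vertex sets that the growth
    property asks for. *)
Lemma subtree_sub_translate w a u : quadrant a -> Omega_at R a w ->
  tree_vertices (lpp_subtree w (a + (site10 + site01))) u ->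
  tree_vertices (lpp_subtree (translate a w) (site10 + site01)) (u - a).
Proof.
move=> qa [a10 a01] [qu /mem_low_path[g [lg ag]]].
move: lg; case/splitPr: ag => p q lg.
have [p1 [p2 pE]] : exists p1 p2, p = p1 ++ a :: p2.
  suff: a \in p by case/splitPr => p1 p2; exists p1, p2.
  (* An empty [p] would make [a + (site10 + site01)] the starting point 0, against [a] in the
     quadrant; otherwise [v] is the site visited just before. *)
  case: (lastP p) lg => [|p' v] lg.
    exfalso; case: lg.1.1 => s [] [+ _ _ _ _]; have /quadrant_ge0[+ _] := qa.
    by rewrite addr0 => ? ?; lia.
  have lv : low_path w v = rcons p' v.
    by apply: (@low_path_prefix _ u _ _ (a + (site10 + site01) :: q));
      rewrite -cat_rcons.
  suff [] : v = a + site10 \/ v = a + site01 by move=> vE; rewrite -lv vE.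
  have : upright_step v (a + (site10 + site01)).
    by move: lg.1.1; rewrite cat_rcons => /path_from_cat[_ [s' [[<-]]]] /andP[].
  rewrite addrA => /upright_stepP[|] /eqP; rewrite ?(inj_eq (addIr _)).
    by rewrite addrAC (inj_eq (addIr _)) => /eqP ->; right.
  by move=> /eqP ->; left.
have lg' : low_optimal w u (p1 ++ a :: (p2 ++ (a + (site10 + site01)) :: q)).
  by move: lg; rewrite pE -catA.
split.
  have [_ pa] := (path_from_cat 0 a u _ _).1 lg'.1.1.
  have [r rE] := path_from_end pa.
  have := path_from_ge pa (u := u); rewrite rE mem_rcons mem_head => /(_ isT).
  by rewrite /quadrant site_subE /=; lia.
apply/mem_low_path; eexists; split; first exact: low_optimal_suffix lg'.
apply/mapP; exists (a + (site10 + site01)); last by rewrite addKr.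
by rewrite inE mem_cat mem_head !orbT.
Qed.

End low_optimal_paths.

Lemma measurable_preimageT d d' (T : measurableType d)
    (T' : measurableType d') (f : T -> T') (B : set T') :
  measurable_fun setT f -> measurable B -> measurable (f @^-1` B).
Proof. by move=> mf mB; rewrite -[X in measurable X]setTI; exact: mf. Qed.

(** * Borel sets of the configuration space and cylinders *)

Section borel_config.
Variable R : realType.
Implicit Types (w : config R) (z : site).

(** Rational endpoints leave only countably many strips, hence countably many finite intersections
    of strips. *)
Definition rat_strip (c : site * (rat * rat)) : set (config R) :=
  [set w | ratr c.2.1 < set_val (w c.1) < ratr c.2.2].

Definition half_line_open_itv (q : rat * rat) : set (half_line R) :=
  [set x | ratr q.1 < set_val x < ratr q.2].

Lemma open_half_line_open_itv q : open (half_line_open_itv q).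
Proof.
exists `]ratr q.1, ratr q.2[%classic; first exact: itv_open.
by apply/seteqP; split=> x /=; rewrite in_itv.
Qed.

Lemma continuous_borel_measurable (S T : ptopologicalType)
    (f : S -> T) :
  continuous f -> measurable_fun setT (f : borel S -> borel T).
Proof.
move=> /continuousP cf.
apply: (@measurability _ _ (borel S) (borel T) setT f (@open T)) => //.
move=> _ [U oU <-].
by rewrite setTI; apply: sub_sigma_algebra; exact: cf.
Qed.

Lemma continuous_eval z : continuous (fun w : config R => w z).
Proof.
exact: (@proj_continuous site (fun=> half_line R) z).
Qed.

Lemma measurable_eval z :
  measurable_fun setT (fun w : borel (config R) => w z : borel (half_line R)).
Proof.
exact: (@continuous_borel_measurable (config R) (half_line R) _
  (@continuous_eval z)).
Qed.

Lemma half_line_nbhs_itv (O : set (half_line R)) (x : half_line R) :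
  open O -> O x ->
  exists2 q, half_line_open_itv q x & half_line_open_itv q `<=` O.
Proof.
case=> W oW <- /= Wx.
have [e /= e0 beW] := (nbhs_ballP _ _).1 (open_nbhs_nbhs (conj oW Wx)).
have /rat_in_itvoo[q1] : set_val x - e < set_val x by rewrite ltrBlDr ltrDl.
have /rat_in_itvoo[q2] : set_val x < set_val x + e by rewrite ltrDl.
rewrite !in_itv /= => /andP[xq2 q2e] /andP[q1e xq1].
exists (q1, q2); first by apply/andP.
move=> y /andP[/= yq1 yq2]; apply: beW; rewrite /ball /= ltr_distlC.
by apply/andP; split; [exact: lt_trans yq1 | exact: lt_trans q2e].
Qed.

(** A basic neighbourhood in the product topology imposes finitely many open conditions on
    coordinates, and each shrinks to a rational interval around the coordinate of [w]. *)
Lemma open_config_strips (U : set (config R)) w : open U -> U w ->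
  exists2 c : seq (site * (rat * rat)), (forall p, p \in c -> rat_strip p w) &
    [set w' | forall p, p \in c -> rat_strip p w'] `<=` U.
Proof.
move=> oU Uw; have : nbhs w U by exact: open_nbhs_nbhs.
case=> [_ [[B sB <-] [C BC Cw] sUBA]].
have /sB [D sD IDeC] := BC.
have strip E : exists c, E \in D -> rat_strip c w /\ rat_strip c `<=` E.
  (* [choice] needs a strip for every [E]; outside [D] any value will do. *)
  have [ED|nED] := boolP (E \in D); last by exists (0, (0, 0)).
  have Ew : E w by move: Cw; rewrite -IDeC; exact.
  have /sD := ED; rewrite inE => -[z _ [W oW EW]].
  have [|q qw qW] := half_line_nbhs_itv oW (x := w z).
    by move: Ew; rewrite -EW.
  by exists (z, q) => _; split=> // w' w'q; rewrite -EW; exact: qW.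
have [f fP] := choice strip.
exists [seq f E | E <- enum_fset D].
  by move=> _ /mapP[E ED ->]; have [] := fP E ED.
move=> w' w'D; apply: sUBA; exists C => //.
suff: C w' by [].
rewrite -IDeC => E ED.
by have [_] := fP E ED; apply; apply: w'D; apply/mapP; exists E.
Qed.

Definition cylinder (F : {fset site}) (B : site -> set (half_line R)) :
  set (config R) := [set w | forall z, z \in F -> B z (w z)].

(** The finite-dimensional events whose probability [product_measure] prescribes. *)
Definition cylinders : set (set (borel (config R))) :=
  [set C | exists (F : {fset site}) (B : site -> set (borel (half_line R))),
     (forall z, measurable (B z)) /\ C = cylinder F B].

Lemma cylinder_measurable F (B : site -> set (borel (half_line R))) :
  (forall z, measurable (B z)) ->
  measurable (cylinder F B : set (borel (config R))).
Proof.
move=> mB; rewrite (_ : cylinder F B =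
    \bigcap_(z in [set` F]) (fun w : borel (config R) => w z) @^-1` B z) //.
apply: fin_bigcap_measurable => // z _.
exact: (measurable_preimageT (measurable_eval z)).
Qed.

Lemma cylinders_setI : setI_closed cylinders.
Proof.
move=> _ _ [F [B [mB ->]]] [F' [B' [mB' ->]]].
exists (F `|` F')%fset, (fun z => (if z \in F then B z else setT) `&`
  (if z \in F' then B' z else setT)); split.
  by move=> z; apply: measurableI; case: ifP.
apply/seteqP; split=> w /=.
  move=> [FB FB'] z zF; split; case: ifP => // zF'; first exact: FB.
  exact: FB'.
move=> H; split=> z zF.
  by have [] := H z; rewrite ?inE zF.
by have [] := H z; rewrite ?inE zF ?orbT.
Qed.

(** An open set is the union of the rational boxes it contains; these are countably many, so the
    product topology yields no Borel set beyond the product sigma-algebra. *)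
Lemma borel_config_cylinders :
  @measurable _ (borel (config R)) = <<s cylinders >>.
Proof.
apply/seteqP; split; last first.
  apply: smallest_sub; first exact: sigma_algebra_measurable.
  by move=> _ [F [B [mB ->]]]; exact: cylinder_measurable.
apply: smallest_sub; first exact: smallest_sigma_algebra.
move=> U oU.
pose T := g_sigma_algebraType cylinders.
have mstrip c : measurable (rat_strip c : set T).
  apply: sub_sigma_algebra.
  exists [fset c.1]%fset, (fun=> half_line_open_itv c.2); split.
    by move=> _; apply: sub_sigma_algebra; exact: open_half_line_open_itv.
  apply/seteqP; split=> w /=; first by move=> cw z /[!inE] /eqP ->.
  by apply; rewrite inE.
pose box (c : seq (site * (rat * rat))) : set T :=
  [set w | forall p, p \in c -> rat_strip p w].
have mbox c : measurable (box c).
  elim: c => [|p c IH].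
    rewrite (_ : box _ = setT) //; apply/seteqP; split=> //.
  rewrite (_ : box _ = rat_strip p `&` box c); first exact: measurableI.
  apply/seteqP; split=> w.
    move=> H; split; first by apply: H; rewrite mem_head.
    by move=> q qc; apply: H; rewrite inE qc orbT.
  by move=> [wp wc] q /[!inE] /orP[/eqP -> //|]; exact: wc.
have -> : U = \bigcup_(c in [set c | box c `<=` U]) box c.
  apply/seteqP; split=> w; last by move=> [c cU]; exact: cU.
  by move=> Uw; have [c cw cU] := open_config_strips oU Uw; exists c.
suff: measurable (\bigcup_(c in [set c | box c `<=` U]) box c : set T) by [].
rewrite bigcup_mkcond; apply: countable_bigcupT_measurable => [|c].
  exact: countableP.
by case: ifP.
Qed.

End borel_config.

(** A pi-lambda argument: the sets [B] whose preimage is independent of [D] are stable under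
    complement and countable disjoint union. *)
Lemma independence_generator d d' (T : measurableType d)
    (T' : measurableType d') (R : realType) (P : probability T R)
    (f : T -> T') (G : set (set T')) (D : set T) :
  measurable_fun setT f -> measurable D ->
  measurable = <<s G >> -> setI_closed G ->
  (forall B, G B -> P (f @^-1` B `&` D) = (P (f @^-1` B) * P D)%E) ->
  forall B, measurable B -> P (f @^-1` B `&` D) = (P (f @^-1` B) * P D)%E.
Proof.
move=> mf mD mG GI GP B mB.
have mfp C : measurable C -> measurable (f @^-1` C).
  exact: measurable_preimageT.
apply: (dynkin_induction (P := fun B =>
  P (f @^-1` B `&` D) = (P (f @^-1` B) * P D)%E) mG GI _ GP).
- by rewrite preimage_setT setTI probability_setT mul1e.
- move=> S mS IH; rewrite preimage_setC setIC -setDE.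
  rewrite (measureD mD (mfp _ mS)); last first.
    by rewrite -ge0_fin_numE ?fin_num_measure.
  rewrite setIC [X in (_ - X)%E]IH probability_setC; last exact: mfp.
  by rewrite muleBl ?mul1e ?fin_num_adde_defr //; exact: fin_num_measure.
- move=> F mF tF IH; rewrite preimage_bigcup setI_bigcupl.
  have mFf k : measurable (f @^-1` F k) by exact: mfp.
  have tFf : trivIset setT (fun k => f @^-1` F k).
    apply/trivIsetP => i j _ _ ij.
    by rewrite -preimage_setI (trivIsetP.1 tF) // preimage_set0.
  rewrite !measure_bigcup //.
  (* [P D] is written as a real number so that it can enter the series as a constant factor. *)
  + rewrite muleC -(fineK (fin_num_measure P D mD)) -nneseriesZl; last first.
      by move=> *; exact: measure_ge0.
    by apply: eq_eseriesr => k _; rewrite [LHS]IH muleC fineK ?fin_num_measure.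
  + by move=> k _; exact: measurableI.
  + exact: trivIset_setIr.
- by rewrite -mG.
Qed.

(** * Measurable maps of configurations and independence of cylinders *)

Section config_measurability.
Variable R : realType.
Implicit Types (w : config R) (z a : site).
Local Notation bconfig := (borel (config R)).
Local Notation bhalf_line := (borel (half_line R)).

Lemma measurable_config_coord (f : bconfig -> bconfig) :
  (forall z, measurable_fun setT
     (fun w : bconfig => (f w : config R) z : bhalf_line)) ->
  measurable_fun setT f.
Proof.
move=> mf; apply: (measurability (@cylinders R)).
  exact: borel_config_cylinders.
move=> _ [_ [F [B [mB ->]]] <-]; rewrite setTI.
rewrite (_ : _ @^-1` _ = \bigcap_(z in [set` F])
    (fun w : bconfig => (f w : config R) z) @^-1` B z) //.
apply: fin_bigcap_measurable => // z _.
exact: (measurable_preimageT (mf z)).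
Qed.

Lemma measurable_translate a :
  measurable_fun setT (translate a : bconfig -> bconfig).
Proof. by apply: measurable_config_coord => z; exact: measurable_eval. Qed.

(** An event equal to its preimage under this map depends only on the weights in [S]; [point] is the
    weight 0. *)
Definition zero_outside (S : set site) (w : bconfig) : bconfig :=
  fun z => if z \in S then w z else point.

Lemma measurable_zero_outside S : measurable_fun setT (zero_outside S).
Proof.
apply: measurable_config_coord => z; rewrite /zero_outside.
by case: (z \in S); [exact: (@measurable_eval R z) | exact: measurable_cst].
Qed.

(** At each site one of the two pulled-back conditions no longer involves the configuration, so the
    product over the sites splits. *)
Lemma product_measure_cylinders (P : probability bconfig R) S B C :
  product_measure P -> cylinders B -> cylinders C ->
  P (zero_outside S @^-1` B `&` zero_outside (~` S) @^-1` C) =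
  (P (zero_outside S @^-1` B) * P (zero_outside (~` S) @^-1` C))%E.
Proof.
move=> [mu muP] [F [B0 [mB ->]]] [F' [C0 [mC ->]]].
(* The spare index set [K] lets both cylinders be written over the same finite set of sites. *)
have restrE U H (B1 : site -> set bhalf_line) K :
  zero_outside U @^-1` cylinder H B1 = cylinder (H `|` K)%fset (fun z =>
    if z \in H then (if z \in U then B1 z else [set _ | B1 z point]) else setT).
  apply/seteqP; split=> w /= cw z.
    move=> _; have := cw z; case: ifP => // _ /(_ isT).
    by rewrite /zero_outside; case: ifP.
  move=> zH; have := cw z; rewrite inE zH /= /zero_outside => /(_ isT).
  by case: ifP.
rewrite (restrE S F _ F') (restrE _ F' _ F) fsetUC.
set B1 := (B1 in cylinder _ B1 `&` _); set C1 := (C1 in _ `&` cylinder _ C1).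
have cstE X (x : half_line R) :
    [set _ : bhalf_line | X x] = setT \/ [set _ : bhalf_line | X x] = set0.
  by case: (pselect (X x)) => Xx; [left|right]; apply/seteqP; split.
have mcond b (X : set bhalf_line) x : measurable X -> measurable
    (if b then X else [set _ | X x] : set bhalf_line).
  by case: b => // _; case: (cstE X x) => ->.
have mB1 (z : site) : measurable (B1 z : set bhalf_line).
  by rewrite /B1; case: ifP => // _; exact: mcond.
have mC1 (z : site) : measurable (C1 z : set bhalf_line).
  by rewrite /C1; case: ifP => // _; exact: mcond.
(* A condition free of the configuration is full or empty, and such a set is independent of any
   other. *)
have BCE z : [\/ B1 z = setT, B1 z = set0, C1 z = setT | C1 z = set0].
  rewrite /B1 /C1 in_setC.
  case: ifP => _; last by constructor 1.
  case: (z \in S) => /=.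
    case: ifP => _; last by constructor 3.
    by case: (cstE (C0 z) point) => ->; [constructor 3 | constructor 4].
  by case: (cstE (B0 z) point) => ->; [constructor 1 | constructor 2].
have triv z : mu z (B1 z `&` C1 z) = (mu z (B1 z) * mu z (C1 z))%E.
  case: (BCE z) => ->; rewrite ?(setTI, setIT, set0I, setI0);
  by rewrite ?probability_setT ?measure0 ?(mul1e, mule1, mul0e, mule0).
rewrite (_ : _ `&` _ = cylinder (F' `|` F)%fset (fun z => B1 z `&` C1 z)).
  rewrite !muP // -?big_split.
    by apply: eq_bigr.
  by move=> z; exact: measurableI.
apply/seteqP; split=> w /=.
  by move=> [BF CF] z zF; split; [exact: BF | exact: CF].
by move=> BC; split=> z /BC[].
Qed.

End config_measurability.

(** * Measurability of the events and the weights they depend on *)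

Section events.
Variable R : realType.
Implicit Types (w : config R) (z a : site) (g : seq site).
Local Notation bconfig := (borel (config R)).

(** The generator argument is used twice: in [B] for fixed [C], then in [C] for a fixed cylinder
    [B]. *)
Lemma product_measure_indep (P : probability bconfig R) S
    (B C : set bconfig) :
  product_measure P -> measurable B -> measurable C ->
  P (zero_outside S @^-1` B `&` zero_outside (~` S) @^-1` C) =
  (P (zero_outside S @^-1` B) * P (zero_outside (~` S) @^-1` C))%E.
Proof.
move=> prodP mB mC.
have mr U (E : set bconfig) : measurable E ->
    measurable (zero_outside U @^-1` E : set bconfig).
  exact: (measurable_preimageT (@measurable_zero_outside R U)).
have mcyl (E : set bconfig) : cylinders E -> measurable E.
  by move=> [F [B0 [mB0 ->]]]; exact: cylinder_measurable.
apply: (independence_generator (measurable_zero_outside S) (mr _ _ mC)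
  (@borel_config_cylinders R) (@cylinders_setI R)) => // {mB}B cB.
rewrite setIC muleC.
apply: (independence_generator (measurable_zero_outside (~` S))
  (mr _ _ (mcyl _ cB)) (@borel_config_cylinders R)
  (@cylinders_setI R)) => // {mC}C cC.
by rewrite setIC muleC; exact: product_measure_cylinders.
Qed.

Lemma continuous_path_length g :
  continuous (fun w : config R => path_length w g).
Proof.
elim: g => [|z g IH] w.
  rewrite (_ : (fun _ => _) = cst 0); first exact: cst_continuous.
  by apply/funext => w'; rewrite /path_length big_nil.
rewrite (_ : (fun _ => _) =
    (fun w' : config R => set_val (w' z) + path_length w' g)); last first.
  by apply/funext => w'; rewrite /path_length big_cons.
have cz : (set_val (w' z) @[w' --> w] --> set_val (w z)).
  apply: (@continuous_comp _ _ _ (fun w' : config R => w' z) set_val).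
    exact: continuous_eval.
  exact: initial_continuous.
exact: (@cvgD R R (config R) (nbhs w) _ (fun w' => set_val (w' z))
  (fun w' => path_length w' g) _ _ cz (IH w)).
Qed.

Lemma measurable_path_length_le g g' :
  measurable [set w : bconfig | path_length w g <= path_length w g'].
Proof.
rewrite (_ : [set _ | _] = ~` ((fun w : config R =>
    path_length w g - path_length w g') @^-1` [set x | 0 < x])).
  apply: measurableC; apply: sub_sigma_algebra.
  apply: open_comp; last exact: open_gt.
  move=> w _; exact: (@cvgB R R (config R) (nbhs w) _
    (fun w => path_length w g) (fun w => path_length w g') _ _
    (@continuous_path_length g w) (@continuous_path_length g' w)).
by apply/seteqP; split=> w; rewrite /= subr_gt0 leNgt => /negP.
Qed.

(** Finite sequences of sites form a countable type, so the quantifier is a countable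
    intersection. *)
Lemma measurable_forall_seq (p : seq site -> set bconfig) :
  (forall g, measurable (p g)) -> measurable [set w | forall g, p g w].
Proof.
move=> mp; rewrite (_ : [set _ | _] = ~` \bigcup_g ~` p g).
  apply/measurableC/countable_bigcupT_measurable; first exact: countableP.
  by move=> g; exact: measurableC.
rewrite setC_bigcup; apply/seteqP; split=> w /= H g.
  by move=> _; rewrite setCK.
by have := H g Logic.I; rewrite setCK.
Qed.

Lemma measurable_imply (A : Prop) (B : set bconfig) : measurable B ->
  measurable [set w | A -> B w].
Proof.
move=> mB; have [a|na] := pselect A.
  by rewrite (_ : [set _ | _] = B) //; apply/seteqP; split=> w /=; auto.
by rewrite (_ : [set _ | _] = setT) //; apply/seteqP; split=> w // _ /na.
Qed.

Lemma measurable_optimal z g : measurable [set w : bconfig | optimal w z g].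
Proof.
rewrite (_ : [set _ | _] = [set w | paths_to z g] `&` [set w : bconfig |
   forall g', paths_to z g' -> path_length w g' <= path_length w g]) //.
apply: measurableI.
  have [pg|npg] := pselect (paths_to z g).
    by rewrite (_ : [set _ | _] = setT) //; apply/seteqP; split.
  by rewrite (_ : [set _ | _] = set0) //; apply/seteqP; split.
apply: measurable_forall_seq => g'; apply: measurable_imply.
exact: measurable_path_length_le.
Qed.

Lemma measurable_low_optimal z g :
  measurable [set w : bconfig | low_optimal w z g].
Proof.
apply: measurableI; first exact: measurable_optimal.
apply: measurable_forall_seq => g'.
(* [below] does not involve the configuration; where it fails, the condition says that [g'] is not
   optimal. *)
have [b|nb] := pselect (below g g').
  by rewrite (_ : (fun _ => _) = setT) //; apply/seteqP; split.
rewrite (_ : (fun _ => _) = ~` [set w : bconfig | optimal w z g']).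
  by apply: measurableC; exact: measurable_optimal.
by apply/seteqP; split=> w /= o /o.
Qed.

Lemma measurable_mem_low_path z a :
  measurable [set w : bconfig | a \in low_path w z].
Proof.
rewrite (_ : [set _ | _] = \bigcup_g ([set w : bconfig | low_optimal w z g] `&`
    (if a \in g then setT else set0))).
  apply: countable_bigcupT_measurable => [|g]; first exact: countableP.
  by apply: measurableI; [exact: measurable_low_optimal | case: ifP].
apply/seteqP; split=> w /=.
  by move=> /mem_low_path[g [lg ag]]; exists g => //; rewrite ag.
by move=> [g _ [/= lg]]; case: ifP => // ag _; apply/mem_low_path; exists g.
Qed.

Lemma measurable_Omega_at a : measurable (Omega_at R a).
Proof. by apply: measurableI; exact: measurable_mem_low_path. Qed.

(* A constant shift [c] of all path lengths is allowed because the paths to [z]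
   share their first and last sites, whose weights are thus irrelevant. *)
Lemma low_path_congr w w' z (c : R) :
  (forall g, paths_to z g -> path_length w g = path_length w' g + c) ->
  low_path w z = low_path w' z.
Proof.
move=> ww'.
have opt (v v' : config R) (d : R) g : (forall g, paths_to z g ->
    path_length v g = path_length v' g + d) -> optimal v z g -> optimal v' z g.
  move=> vv' [pg og]; split=> // g' pg'.
  by have := og _ pg'; rewrite !vv' // lerD2r.
have optE g : optimal w z g <-> optimal w' z g.
  split; first exact: opt ww'.
  move=> o; refine (opt w' w (- c) g _ o) => g' pg'.
  by rewrite ww' // addrK.
congr xget; apply/seteqP.
by split=> g [/optE og lg]; split=> // g' /optE; exact: lg.
Qed.

Lemma low_path_congr_level w w' z :
  (forall u, level u < level z -> w u = w' u) -> low_path w z = low_path w' z.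
Proof.
move=> ww'; apply: (@low_path_congr _ _ _ (set_val (w z) - set_val (w' z))).
move=> g pg; have [p gE] := path_from_end pg.
rewrite /path_length gE -cats1 !big_cat !big_seq1 /= -addrA subrKC.
congr (_ + _); rewrite !big_seq; apply: eq_bigr => u up; rewrite ww' //.
have ip : (index u p < size p)%N by rewrite index_mem.
have := @path_from_level _ _ _ (index u p) pg; rewrite (path_from_size pg).
by rewrite gE size_rcons nth_rcons ip nth_index // => -> //; exact: ltnW.
Qed.

Lemma low_path_congr_quadrant w w' z :
  (forall u, quadrant u -> u != 0 -> w u = w' u) ->
  low_path w z = low_path w' z.
Proof.
move=> ww'; apply: (@low_path_congr _ _ _ (set_val (w 0) - set_val (w' 0))).
move=> g pg; have [s [gE _ _]] := pg.
rewrite /path_length gE !big_cons addrAC subrKC; congr (_ + _).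
rewrite !big_seq; apply: eq_bigr => u us; rewrite ww' //.
  have := path_from_ge pg (u := u); rewrite gE inE us orbT.
  by move=> /(_ isT).
(* A site of [s] sits at a position at least 1 of [g], so its level is positive and it is not 0. *)
apply/eqP => u0.
have := @path_from_level _ _ _ (index u s).+1 pg.
by rewrite gE /= ltnS index_mem nth_index // us u0 => /(_ isT).
Qed.

Lemma lpp_subtree_congr w w' z :
  (forall u, quadrant u -> u != 0 -> w u = w' u) ->
  lpp_subtree w z = lpp_subtree w' z.
Proof.
move=> ww'; have lpE : low_path w = low_path w'.
  by apply/funext => u; exact: low_path_congr_quadrant.
by rewrite /lpp_subtree /lpp_tree lpE.
Qed.

(** Translations are invertible; written as a preimage, the image of an event is measurable. *)
Lemma translate_image a (B : set bconfig) :
  translate a @` B = translate (- a) @^-1` B.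
Proof.
apply/seteqP; split=> w /=.
  move=> [w' Bw' <-]; rewrite (_ : translate _ _ = w') //.
  by apply/funext => z; rewrite /translate addNKr.
move=> Bw; exists (translate (- a) w) => //.
by apply/funext => z; rewrite /translate addKr.
Qed.

End events.

Theorem theorem2 (R : realType) (P : probability (borel (config R)) R)
  (hP : translation_invariant P) (a : site) (ha : quadrant a)
  (A : set rooted_tree) (hA : growth_property R A)
  (hmeasa : measurable (subtree_in R (a + (site10 + site01)) A))
  (hmeas : measurable (subtree_in R (site10 + site01) A)) :
  (P (subtree_in R (a + (site10 + site01)) A `&` Omega_at R a)
     <= P (subtree_in R (site10 + site01) A `&` (translate a @` Omega_at R a)))%E /\
  (product_measure P -> (0 < P (Omega_at R a))%E ->
    (cond_prob P (subtree_in R (a + (site10 + site01)) A) (Omega_at R a)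
       <= P (subtree_in R (site10 + site01) A))%E).
Proof.
pose b := site10 + site01 : site.
have mtr (B : set (borel (config R))) : measurable B ->
    measurable (translate a @^-1` B : set (borel (config R))).
  exact: (measurable_preimageT (@measurable_translate R a)).
have mOa := @measurable_Omega_at R a.
have mD : measurable (translate a @` Omega_at R a : set (borel (config R))).
  rewrite translate_image.
  exact: (measurable_preimageT (@measurable_translate R (- a)) mOa).
have main : (P (subtree_in R (a + b) A `&` Omega_at R a)
     <= P (subtree_in R b A `&` (translate a @` Omega_at R a)))%E.
  have mED : measurable (subtree_in R b A `&`
      (translate a @` Omega_at R a : set (borel (config R)))).
    exact: measurableI.
  (* Invariance replaces the right-hand event by its preimage under [translate a], so an inclusion
     of events suffices. *)
  rewrite -(hP a _ mED); apply: le_measure; rewrite ?inE.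
  - exact: measurableI.
  - exact: mtr.
  move=> w [Aw Oaw]; split; last by exists w.
  apply: (hA.2 _ _ Aw); first by exists (translate a w), b.
  move=> _ [u uV <-]; exists (u - a).
    exact: subtree_sub_translate.
  by change (u - a - b = u - (a + b)); rewrite (opprD a b) addrA.
split=> // prodP Oa0.
have PD : P (translate a @` Omega_at R a) = P (Omega_at R a).
  rewrite -(hP a _ mD) translate_image; congr (P _); apply/funext => w.
  congr (Omega_at R a _); apply/funext => z.
  by rewrite /translate addNKr.
(* [S] holds the weights the tree depends on; every site of level at most 0 lies in its
   complement. *)
pose S : set site := [set z | quadrant z /\ z != 0].
have ES : zero_outside S @^-1` subtree_in R b A = subtree_in R b A.
  apply/funext => w; rewrite /subtree_in /preimage /=; congr A.
  apply: lpp_subtree_congr => u qu u0; rewrite /zero_outside.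
  by rewrite mem_set.
have DS : zero_outside (~` S) @^-1` (translate a @` Omega_at R a) =
    translate a @` Omega_at R a.
  rewrite translate_image; apply/funext => w.
  (* Both [a + site10] and [a + site01] have this level; a site [u] of lower level is read at
     [- a + u], of level at most 0, where the quadrant has only the site 0. *)
  have lE v : level v = level a + 1 ->
      low_path (translate (- a) (zero_outside (~` S) w)) v =
      low_path (translate (- a) w) v.
    move=> va; apply: low_path_congr_level => u ua.
    rewrite /translate /zero_outside ifT //; apply/mem_set.
    move=> [/quadrant_ge0 q /eqP]; apply; move: ua q; rewrite va /level.
    by rewrite site_addE /= => ua [q1 q2]; congr pair; lia.
  by rewrite /preimage /= /Omega_at /= !lE // /level site_addE /=; lia.
have indep : P (subtree_in R b A `&` (translate a @` Omega_at R a)) =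
    (P (subtree_in R b A) * P (Omega_at R a))%E.
  rewrite -PD -{1}ES -{1}DS product_measure_indep //.
  by rewrite ES DS.
have Ofin := fin_num_measure P _ mOa.
have r0 : 0 < fine (P (Omega_at R a)) by rewrite fine_gt0 // Oa0 ltey_eq Ofin.
(* [P (Omega_at R a)] is finite and positive, so the division has a real divisor. *)
rewrite /cond_prob -[X in (_ / X)%E](fineK Ofin) inver gt_eqF //.
by rewrite lee_pdivrMr // fineK // -indep.
Qed.
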